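(* Let $G$ be a finite undirected graph (possibly with loops and multiple edges) with nonempty vertex set $V$ and edge set $E$, and let $b\in\mathbb{R}^V$ be nonzero with all entries nonnegative. Let $u$ and $w$ be distinct vertices of the polytope $\mathcal{P}(G,b)$. Then $u$ and $w$ are the vertices of an edge of $\mathcal{P}(G,b)$ if and only if $u$ and $w$ are the only vertices of $\mathcal{P}(G,b)$ whose graphs are contained in the union $\mathrm{gr}(u)\cup\mathrm{gr}(w)$ of the graphs of $u$ and $w$.
   Context: $\delta_G(v)$ denotes the set of edges of $G$ incident with $v$; a loop at $v$ appears once in $\delta_G(v)$. $\mathcal{P}(G,b)=\{x\in\mathbb{R}^E \mid x_e\ge 0 \text{ for each } e\in E,\ \sum_{e\in\delta_G(v)}x_e=b_v \text{ for each } v\in V\}$. An edge of a polytope is a one-dimensional face. For $x\in\mathcal{P}(G,b)$, the graph $\mathrm{gr}(x)$ of $x$ is the spanning subgraph of $G$ (vertex set $V$) with edge set $\{e\in E\mid x_e>0\}$. Union and containment of spanning subgraphs of $G$ mean union and containment of their edge sets. *)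

(* Defs.v *)
From mathcomp Require Import all_boot all_order all_algebra.
From mathcomp Require Import classical_sets reals.

Set Implicit Arguments.
Unset Strict Implicit.
Unset Printing Implicit Defensive.

Import Order.TTheory GRing.Theory Num.Theory.
Local Open Scope ring_scope.

Section Polyhedra.
Variables (R : realType) (W : vectType R).
Implicit Types (P F : set W) (x v : W).

Definition affine_hull F : set W :=
  [set y | exists (n : nat) (a : 'I_n -> R) (p : 'I_n -> W),
     [/\ forall i, F (p i), \sum_i a i = 1 & y = \sum_i a i *: p i]]%classic.

(* The empty set, of conventional dimension -1, satisfies this for no [d]. *)
Definition aff_dim F (d : nat) : Prop :=
  exists x0 (U : {vspace W}),
    affine_hull F = [set x0 + y | y in [set y | y \in U]]%classic /\ \dim U = d.

(* [c = 0] gives the improper faces [P] and the empty set. *)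
Definition face P F : Prop :=
  exists (c : 'Hom(W, R^o)) (beta : R),
    (forall x, P x -> (c x : R) <= beta) /\
    F = [set x | P x /\ c x = beta]%classic.

Definition vertex P v : Prop :=
  exists F, [/\ face P F, aff_dim F 0 & F v].

Definition edge P F : Prop := face P F /\ aff_dim F 1.

Definition vertices_of_edge P u w : Prop :=
  exists F, edge P F /\ forall v, vertex F v <-> v = u \/ v = w.

End Polyhedra.

(* Parallel edges are distinct elements of [E] with the same [ends]; a loop is
   an edge whose [ends] is a singleton. *)
Record multigraph (V E : finType) := Multigraph {
  ends : E -> {set V};
  card_ends : forall e, (0 < #|ends e| <= 2)%N
}.

Section GraphPolytope.
Variables (R : realType) (V E : finType).
Implicit Types (G : multigraph V E) (b : {ffun V -> R}) (x : {ffun E -> R^o}).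

Definition delta G (v : V) : {set E} := [set e | v \in ends G e].

(* [R^o] makes the space of vectors indexed by [E] a [vectType R]. *)
Definition polytope G b : set {ffun E -> R^o} :=
  [set x : {ffun E -> R^o} | (forall e, 0 <= (x e : R)) /\
           (forall v, \sum_(e in delta G v) (x e : R) = b v)]%classic.

(* A spanning subgraph of [G] is identified with its set of edges. *)
Definition gr x : {set E} := [set e | 0 < (x e : R)].

End GraphPolytope.

(* Main.v *)
(** A point [v] of the polytope is a vertex iff it is the only point of the
    polytope whose graph is contained in [gr v], and the points whose graphs lie
    in a fixed edge set [S] always form a face.  With [S := gr u :|: gr w], the
    graph of the midpoint of [u] and [w], this face [F] lies in every face
    containing both [u] and [w], so all vertices with graph in [S] belong to the
    edge when there is one.  Conversely, moving from a point of [F] that is not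
  X    as a combination of points with smaller graphs; hence, when [u] and [w] are
    the only vertices in [F], all of [F] lies on the line through them. *)
Require Import Defs.
From mathcomp Require Import all_boot all_order all_algebra.
From mathcomp Require Import classical_sets reals.
From mathcomp Require Import boolp ring lra.
From HB Require Import structures.

Set Implicit Arguments.
Unset Strict Implicit.
Unset Printing Implicit Defensive.

Import Order.TTheory GRing.Theory Num.Theory.
Local Open Scope ring_scope.

(** * Faces and vertices of arbitrary sets, through linear functionals *)

Section Faces.
Variables (R : realType) (W : vectType R).
Implicit Types (P F : set W) (x v : W).

Lemma sub_affine_hull F x : F x -> affine_hull F x.
Proof.
move=> Fx; exists 1%N, (fun=> 1), (fun=> x); split => //.
  by rewrite big_ord1.
by rewrite big_ord1 scale1r.
Qed.

Lemma aff_dim0_eq F v x : aff_dim F 0 -> F v -> F x -> x = v.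
Proof.
move=> [x0 [U [hull /eqP]]]; rewrite dimv_eq0 => /eqP U0 Fv Fx.
have eq_x0 y : F y -> y = x0.
  move=> /sub_affine_hull; rewrite hull => -[z /=].
  by rewrite U0 memv0 => /eqP -> <-; rewrite addr0.
by rewrite (eq_x0 x Fx) (eq_x0 v Fv).
Qed.

Lemma aff_dim_set1 v : aff_dim [set v]%classic 0.
Proof.
exists v, 0%VS; split; last exact: dimv0.
apply/seteqP; split=> [y [n [a [p [pv a1 ->]]]]|y [z /=]].
  exists 0; first by rewrite /= mem0v.
  rewrite addr0; under eq_bigr => i _ do rewrite (pv i).
  by rewrite -scaler_suml a1 scale1r.
by rewrite memv0 => /eqP -> <-; rewrite addr0; apply: sub_affine_hull.
Qed.

(** A face of affine dimension 0 is a single point, so the functional defining it has a strict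
    maximum there. This form drops faces and dimensions from the later arguments. *)
Lemma vertexP P v :
  vertex P v <->
  P v /\ exists c : 'Hom(W, R^o),
    forall x, P x -> x <> v -> (c x : R) < c v.
Proof.
split=> [[F [[c [beta [leb defF]]] F0 Fv]]|[Pv [c cP]]].
  have [Pv cv] : P v /\ c v = beta by move: Fv; rewrite defF.
  split=> //; exists c => x Px nxv; rewrite lt_neqAle cv leb // andbT.
  by apply/eqP => cx; apply: nxv; apply: (aff_dim0_eq F0 Fv); rewrite defF.
exists [set v]%classic; split=> //; last exact: aff_dim_set1.
exists c, (c v); split=> [x Px|].
  by have [->//|/eqP nxv] := eqVneq x v; apply/ltW/cP.
apply/seteqP; split=> [x ->|x [Px cxv]]; first by split.
by apply: contrapT => /(cP x Px); rewrite cxv ltxx.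
Qed.

(** A strict maximum over [P] stays strict over any subset that contains [v]; [F] may be any
    subset. *)
Lemma vertex_sub P F v :
  (F `<=` P)%classic -> F v -> vertex P v -> vertex F v.
Proof.
move=> sFP Fv /vertexP[_ [c cP]]; apply/vertexP; split=> //.
by exists c => x /sFP; apply: cP.
Qed.

Lemma aff_dim_line F u w : F u -> F w -> u <> w ->
  (forall x, F x -> exists s, x = u + s *: (w - u)) -> aff_dim F 1.
Proof.
move=> Fu Fw nuw line; exists u, <[w - u]>%VS; split; last first.
  by rewrite dim_vline subr_eq0 eq_sym; case: eqP.
apply/seteqP; split=> [y [n [a [p [Fp a1 ->]]]]|y [z /= /vlineP[s ->] <-]].
  have [s sP] := choice (fun i => line _ (Fp i)).
  exists (\sum_i (a i * s i) *: (w - u)).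
    by rewrite /=; apply: memv_suml => i _; rewrite memvZ ?memv_line.
  under [RHS]eq_bigr => i _ do rewrite (sP i) scalerDr scalerA.
  by rewrite big_split /= -!scaler_suml a1 scale1r.
exists 2%N, (fun i => if i == ord0 then 1 - s else s),
  (fun i => if i == ord0 then u else w).
split=> [i||]; first by case: ifP.
  by rewrite big_ord_recl big_ord1 /= subrK.
by rewrite big_ord_recl big_ord1 /= scalerBl scalerBr scale1r addrA addrAC.
Qed.

End Faces.

(** * Moving within the polytope until the graph shrinks *)

Section GraphPolytopeVertices.
Variables (R : realType) (V E : finType) (G : multigraph V E).
Variable b : {ffun V -> R}.
Implicit Types (x y d u v w : {ffun E -> R^o}) (S : {set E}).

Let P := polytope G b.

Lemma gr_subP x S : (forall e, 0 <= (x e : R)) ->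
  reflect (forall e, e \notin S -> x e = 0) (gr x \subset S).
Proof.
move=> x0; apply: (iffP fintype.subsetP) => [sxS e neS|zS e].
  by apply/eqP; rewrite eq_le x0 andbT leNgt; apply: contra neS => xe;
    apply: sxS; rewrite inE.
by rewrite inE; apply: contraTT => /zS ->; rewrite ltxx.
Qed.

Lemma sum_delta_sub x y (i : V) : P x -> P y ->
  \sum_(e in delta G i) ((x - y) e : R) = 0.
Proof.
move=> [_ xb] [_ yb]; under eq_bigr => e _ do rewrite !ffunE.
by rewrite sumrB xb yb subrr.
Qed.

(** Every edge has an end, so each coordinate occurs in some vertex sum; nonnegative terms with sum
    zero all vanish. *)
Lemma exists_neg_coord d : d <> 0 ->
  (forall i : V, \sum_(e in delta G i) (d e : R) = 0) ->
  exists e, (d e : R) < 0.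
Proof.
move=> d0 dG; apply: contrapT => nneg; apply: d0; apply/ffunP => e.
have dge0 f : 0 <= (d f : R).
  by rewrite leNgt; apply/negP => ?; apply: nneg; exists f.
have /card_gt0P[v ve] : (0 < #|ends G e|)%N by case/andP: (card_ends G e).
have eD : e \in delta G v by rewrite inE.
move/eqP: (dG v); rewrite psumr_eq0 // => /allP/(_ e).
by rewrite mem_index_enum eD /= => /(_ isT)/eqP ->; rewrite ffunE.
Qed.

(** This is the ratio test of the simplex method: follow [d] until the first coordinate of [x] drops
    to zero. *)
Lemma polytope_step x d : P x -> d <> 0 ->
  (forall i : V, \sum_(e in delta G i) (d e : R) = 0) ->
  (forall e, x e = 0 -> d e = 0) ->
  exists t : R, [/\ 0 < t, P (x + t *: d) & gr (x + t *: d) \proper gr x].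
Proof.
move=> [x0 xb] d0 dG dx; have [e0 de0] := exists_neg_coord d0 dG.
(* For [d e < 0], coordinate [e] vanishes after a step of length [r e]; the least such length keeps
   all coordinates nonnegative. *)
pose r e : R := (x e : R) / - (d e : R).
have [e de rmin] := @arg_minP _ _ _ e0 (fun e => (d e : R) < 0) r de0.
have xgt0 f : d f != 0 -> 0 < (x f : R).
  by move=> df; rewrite lt_neqAle x0 andbT eq_sym; apply: contra df => /eqP/dx ->.
have stepE f : (x + r e *: d) f = ((x f : R) + r e * (d f : R) : R) by rewrite !ffunE.
have rgt0 : 0 < r e by rewrite divr_gt0 ?oppr_gt0 // xgt0 // lt_eqF.
have step0 f : 0 <= ((x + r e *: d) f : R).
  rewrite stepE; have [df|df] := ltP (d f : R) 0; last first.
    by rewrite addr_ge0 // mulr_ge0 // ltW.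
  by have := rmin f df; rewrite {2}/r ler_pdivlMr ?oppr_gt0 // mulrN -subr_ge0 opprK.
exists (r e); split=> //.
  split=> // v; under eq_bigr => f _ do rewrite stepE.
  by rewrite big_split /= -mulr_sumr dG mulr0 addr0 xb.
apply/properP; split.
  apply/gr_subP => // f; rewrite inE -leNgt => xf.
  have xf0 : x f = 0 by apply/eqP; rewrite eq_le xf x0.
  by rewrite stepE (dx f xf0) xf0 mulr0 addr0.
exists e; first by rewrite inE xgt0 // lt_eqF.
rewrite inE stepE /r.
have -> : (x e : R) + (x e : R) / - (d e : R) * (d e : R) = 0.
  by rewrite invrN mulrN mulNr divfK ?subrr // lt_eqF.
by rewrite ltxx.
Qed.

(** The sign of [a] selects the direction on the line through [x] and [y]: away from [y] when
    positive, towards [y] when negative. *)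
Lemma polytope_step_line x y (a : R) :
  a != 0 -> P x -> P y -> y <> x -> gr y \subset gr x ->
  exists t : R, [/\ 0 < t, P (x + (t * a) *: (x - y)) &
                    gr (x + (t * a) *: (x - y)) \proper gr x].
Proof.
move=> a0 Px Py nyx syx.
have [||e xe|t] := @polytope_step x (a *: (x - y)) Px.
- move/eqP; rewrite scaler_eq0 (negPf a0) subr_eq0 /= eq_sym => /eqP.
  exact: nyx.
- move=> v; transitivity (\sum_(e in delta G v) a * ((x - y) e : R)).
    by apply: eq_bigr => e _; rewrite ffunE.
  by rewrite -mulr_sumr sum_delta_sub // mulr0.
- by rewrite !ffunE xe (gr_subP _ Py.1 syx) ?subrr ?scaler0 // inE xe ltxx.
- by rewrite scalerA; exists t.
Qed.

(** * Faces cut out by edge sets, and their vertices *)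

Lemma lfun_exists (f : {ffun E -> R^o} -> R^o) : linear f ->
  exists c : 'Hom({ffun E -> R^o}, R^o), forall x, c x = f x.
Proof.
move=> lf.
pose mf := GRing.isLinear.Build R {ffun E -> R^o} R^o *:%R f lf.
pose g : {linear {ffun E -> R^o} -> R^o} := HB.pack f mf.
by exists (linfun g) => x; rewrite lfunE.
Qed.

Definition graph_face S : set {ffun E -> R^o} :=
  [set x | P x /\ gr x \subset S]%classic.

(** Minus the sum of the coordinates outside [S] works: it is zero only when these nonnegative
    coordinates all vanish. *)
Lemma graph_face_functional S : exists c : 'Hom({ffun E -> R^o}, R^o),
  forall x, P x -> (c x : R) <= 0 /\ (c x = 0 <-> gr x \subset S).
Proof.
have [|c cE] := @lfun_exists (fun x => - \sum_(e | e \notin S) x e).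
  move=> a x y; under eq_bigr => e _ do rewrite !ffunE.
  by rewrite big_split /= -scaler_sumr opprD scalerN.
exists c => x [x0 _]; rewrite cE; split; first by rewrite oppr_le0 sumr_ge0.
split=> [/eqP|/(gr_subP _ x0) zS]; last by rewrite big1 ?oppr0.
rewrite oppr_eq0 psumr_eq0 // => /allP z; apply/gr_subP => // e neS.
by have := z e; rewrite mem_index_enum neS => /(_ isT)/eqP.
Qed.

Lemma face_graph_face S : face P (graph_face S).
Proof.
have [c cP] := graph_face_functional S; exists c, 0.
split=> [x /cP[]//|]; apply/seteqP.
by split=> x [Px] /(cP x Px).2 ?.
Qed.

Lemma vertex_graph_face_eq S v x :
  vertex (graph_face S) v -> P x -> gr x \subset gr v -> x = v.
Proof.
move=> /vertexP[[Pv vS] [c cP]] Px xv; apply: contrapT => nxv.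
have [t [t0 Pt /proper_sub tv]] := polytope_step_line (oner_neq0 R) Pv Px nxv xv.
(* [v] lies strictly between [x] and [v + t *: (v - x)], so [c] cannot be smaller than [c v] at
   both. *)
have cx : (c x : R) < c v by apply: cP => //; split=> //; apply: fintype.subset_trans vS.
have ct : (c (v + (t * 1) *: (v - x)) : R) < c v.
  apply: cP; first by split=> //; apply: fintype.subset_trans tv vS.
  move/eqP; rewrite -subr_eq0 addrAC subrr add0r scaler_eq0 mulr1 gt_eqF //=.
  by rewrite subr_eq0 eq_sym => /eqP.
move: ct; rewrite linearD linearZ /= linearB /= mulr1 gtrDl.
by rewrite pmulr_rlt0 // subr_lt0 ltNge ltW.
Qed.

Lemma polytope_vertexP v :
  vertex P v <-> P v /\ forall x, P x -> gr x \subset gr v -> x = v.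
Proof.
split=> [Vv|[Pv uniq_v]].
  split=> [|x]; first by case/vertexP: Vv.
  (* With all edges allowed, the graph face is the whole polytope. *)
  apply: (@vertex_graph_face_eq [set: E]); apply: vertex_sub (Vv) => [y []//|].
  by split; [case/vertexP: Vv | exact: finset.subsetT].
exists (graph_face (gr v)); split; [exact: face_graph_face| |by split].
suff -> : graph_face (gr v) = [set v]%classic by exact: aff_dim_set1.
by apply/seteqP; split=> [x [Px /(uniq_v x Px)]|x ->].
Qed.

Lemma vertex_graph_face S v :
  vertex (graph_face S) v <-> vertex P v /\ gr v \subset S.
Proof.
split=> [Vv|[Vv vS]].
  have [[Pv vS] _] := (vertexP _ _).1 Vv; split=> //.
  apply/polytope_vertexP; split=> // x; exact: vertex_graph_face_eq Vv.
apply: vertex_sub (Vv) => [x []//|].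
by split=> //; case/vertexP: Vv.
Qed.

(** * Graph faces and the line through two vertices *)

Lemma line_combination x z u w (s t a c : R) : 0 < s -> 0 < t ->
  x + s *: z = u + a *: w -> x - t *: z = u + c *: w ->
  x = u + ((t * a + s * c) / (s + t)) *: w.
Proof.
move=> s0 t0 xsz xtz; apply: (@scalerI _ _ (s + t)).
  by rewrite gt_eqF // addr_gt0.
rewrite scalerDr scalerA mulrC divfK ?gt_eqF ?addr_gt0 //.
transitivity (t *: (x + s *: z) + s *: (x - t *: z)).
  by apply/ffunP => e; rewrite !ffunE /GRing.scale /=; ring.
by rewrite xsz xtz; apply/ffunP => e; rewrite !ffunE /GRing.scale /=; ring.
Qed.

(** By induction on the number of edges of [gr x]: a point that is not a vertex lies between two
    points with smaller graphs, both on the line. *)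
Lemma graph_face_line S u w :
  (forall v, vertex P v -> gr v \subset S -> v = u \/ v = w) ->
  forall x, graph_face S x -> exists s, x = u + s *: (w - u).
Proof.
move=> only_uw x; have [n] := ubnP #|gr x|.
elim: n x => // n IHn x /ltnSE xn [Px xS].
have [Vx|nVx] := pselect (vertex P x).
  have [->|->] := only_uw x Vx xS; first by exists 0; rewrite scale0r addr0.
  by exists 1; rewrite scale1r addrC subrK.
have [y [Py nyx yx]] : exists y, [/\ P y, y <> x & gr y \subset gr x].
  apply: contrapT => none; apply/nVx/polytope_vertexP; split=> // y Py yx.
  by apply: contrapT => nyx; apply: none; exists y.
have IH z : P z -> gr z \proper gr x -> exists s, z = u + s *: (w - u).
  move=> Pz zx; apply: IHn; last first.
    by split=> //; apply: fintype.subset_trans xS; apply: proper_sub.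
  by apply: leq_trans xn; apply: proper_card.
have N1 : -1 != 0 :> R by rewrite oppr_eq0 oner_neq0.
have [s [s0 Ps /(IH _ Ps)[a]]] := polytope_step_line (oner_neq0 R) Px Py nyx yx.
have [t [t0 Pt /(IH _ Pt)[c]]] := polytope_step_line N1 Px Py nyx yx.
rewrite mulr1 mulrN1 scaleNr => xt xs.
by eexists; apply: line_combination xs xt.
Qed.

(** The midpoint [m] of [u] and [w] lies in [F] and its graph contains [gr x], so the segment from
    [x] to [m] can be prolonged beyond [m] inside [P]. *)
Lemma graph_face_sub_face F u w : face P F -> F u -> F w ->
  (graph_face (gr u :|: gr w) `<=` F)%classic.
Proof.
move=> [c [beta [leb ->]]] [[u0 ub] cu] [[w0 wb] cw] x [Px xS]; split=> //.
pose m : {ffun E -> R^o} := 2^-1 *: (u + w).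
have mE e : m e = 2^-1 * ((u e : R) + (w e : R)) :> R by rewrite !ffunE.
have Pm : P m.
  split=> [e|v]; first by rewrite mE mulr_ge0 ?invr_ge0 ?addr_ge0.
  under eq_bigr => e _ do rewrite mE.
  by rewrite -mulr_sumr big_split /= ub wb; lra.
have cm : c m = beta :> R.
  by rewrite linearZ linearD /= cu cw /GRing.scale /=; lra.
have xm : gr x \subset gr m.
  apply: fintype.subset_trans xS _; apply/fintype.subsetP => e; rewrite !inE mE.
  by move: (u0 e) (w0 e) => ue we /orP[]; lra.
have [<-//|/eqP nxm] := eqVneq m x.
have [t [t0 Pt _]] := polytope_step_line (oner_neq0 R) Pm Px (nesym nxm) xm.
clearbody m.
have cE : c (m + (t * 1) *: (m - x)) = (c m : R) + t * ((c m : R) - c x) :> R.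
  by rewrite mulr1 linearD linearZ linearB.
(* As [c m = beta], a value of [c] below [beta] at [x] would give one above [beta] beyond [m]. *)
apply/eqP; rewrite eq_le leb //=; move: (leb _ Pt); rewrite cE cm gerDl.
by rewrite pmulr_rle0 // subr_le0.
Qed.

End GraphPolytopeVertices.

Theorem corollary31 (R : realType) (V E : finType) (G : multigraph V E)
    (b : {ffun V -> R}) (u w : {ffun E -> R^o}) :
  (0 < #|V|)%N ->
  (exists v, b v <> 0) ->
  (forall v, 0 <= b v) ->
  vertex (polytope G b) u ->
  vertex (polytope G b) w ->
  u <> w ->
  (vertices_of_edge (polytope G b) u w
   <->
   (forall v : {ffun E -> R^o},
      vertex (polytope G b) v /\ gr v \subset gr u :|: gr w
      <-> v = u \/ v = w)).
Proof.
move=> _ _ _ Vu Vw nuw; split=> [[F [[faceF _] VF]] v|only_uw].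
  split=> [[Vv vS]|[] ->]; last 2 first.
  - by split=> //; apply: finset.subsetUl.
  - by split=> //; apply: finset.subsetUr.
  have [Fu _] := (vertexP _ _).1 ((VF u).2 (or_introl erefl)).
  have [Fw _] := (vertexP _ _).1 ((VF w).2 (or_intror erefl)).
  (* A vertex of the polytope lying in [F] is a vertex of [F], so only membership in [F] remains. *)
  apply/VF; apply: vertex_sub (Vv); first by case: faceF => [c [beta [_ ->]]] x [].
  apply: graph_face_sub_face faceF Fu Fw _ _.
  by split=> //; case/vertexP: Vv.
exists (graph_face G b (gr u :|: gr w)); split=> [|v]; last first.
  by split=> [/vertex_graph_face|] /only_uw // /vertex_graph_face.
split; first exact: face_graph_face.
have [Pu _] := (vertexP _ _).1 Vu; have [Pw _] := (vertexP _ _).1 Vw.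
apply: (@aff_dim_line _ _ _ u w) => //.
- by split=> //; apply: finset.subsetUl.
- by split=> //; apply: finset.subsetUr.
- by apply: graph_face_line => v Vv vS; apply/only_uw.
Qed.
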